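(* Let $(r_n)_{n<\omega}$ be a sequence of real numbers such that $r=\lim_{n\to\infty} r_n$ exists in the classical sense of real analysis, where $r$ is either a real number or $r=+\infty$ or $r=-\infty$; here $+\infty$ is identified with the surreal number $\omega$ and $-\infty$ with $-\omega$. Then \[ \lim_{n\to\infty} r_n \;=\; \operatorname{s\text{-}lim}_{n<\omega} r_n + \varepsilon, \] where $\varepsilon$ is one of $0$, $1/\omega$, or $-1/\omega$, and $+$ denotes surreal addition.
   Context: Surreal numbers are identified with their sign expansions: a surreal number is a function $s:\alpha_s\to\{+,-\}$ for some ordinal $\alpha_s$ (depending on $s$). For $\beta<\alpha_s$, $s(\beta)$ is called place $\beta$ of $s$; places $\geq\alpha_s$ are called undefined. The surreal order compares two sign expansions at the first place where they differ, with the convention $- <$ undefined $< +$. Real numbers are regarded as surreal numbers in the standard way (e.g. the empty sequence is $0$, the sequence of $n$ pluses is the natural number $n$, $\omega$ is the sequence of $\omega$ pluses, and $1/\omega$ is $+$ followed by $\omega$ minuses, i.e. $+---\cdots$); addition is surreal addition, which agrees with ordinary addition on reals. Definition (s-limit). If $(s_n)_{n<\omega}$ is a sequence of surreal numbers, $\operatorname{s\text{-}lim}_{n<\omega} s_n$ is the surreal $s$ such that place $\gamma$ of $s$ is defined if and only if there is $m<\omega$ such that for every $n\geq m$ the places $\gamma'\le\gamma$ of $s_n$ are all defined and the sign expansions of the $s_n$ ($n\ge m$) are identical up to place $\gamma$ included; in that case $s(\gamma)=s_m(\gamma)$. (The set of defined places is an initial segment of the ordinals, so $s$ is a well-defined surreal,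 possibly the empty sequence $0$.) *)

(* Defs.v *)
From HB Require Import structures.
From Stdlib Require Import Wellfounded Relation_Operators.
From mathcomp Require Import all_boot all_order all_algebra.
From mathcomp Require Import generic_quotient.
From mathcomp Require Import all_classical all_reals all_analysis.

Set Implicit Arguments.
Unset Strict Implicit.
Unset Printing Implicit Defensive.

Import Order.TTheory GRing.Theory Num.Theory.
Import numFieldNormedType.Exports.

Local Open Scope classical_set_scope.

(* [Sup f] denotes the least ordinal strictly above every [f a].  Several terms
   may denote the same ordinal; [ordnum] is the quotient by that relation, so
   that it consists of all the ordinals of a universe, with Leibniz equality. *)
Inductive preord : Type := Sup (A : Type) of (A -> preord).

Fixpoint ple (x y : preord) : Prop :=
  match x with
  | Sup _ f => forall a, match y with Sup _ g => exists b, ple (f a) (g b) end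
  end.

Definition plt (x y : preord) : Prop :=
  match y with Sup _ g => exists b, ple x (g b) end.

Lemma pleE (A : Type) (f : A -> preord) y :
  ple (Sup f) y = forall a, plt (f a) y.
Proof. by case: y. Qed.

Lemma ple_refl x : ple x x.
Proof. by elim: x => A f IH; rewrite pleE => a; exists a. Qed.

Lemma ple_trans y x z : ple x y -> ple y z -> ple x z.
Proof.
elim: x y z => A f IH [B g] [C h]; rewrite !pleE => xy yz a.
have [b ab] := xy a; have [c bc] := yz b.
by exists c; apply: IH ab bc.
Qed.

Lemma ple_plt_trans y x z : ple x y -> plt y z -> plt x z.
Proof. by case: z => C h xy [c yc]; exists c; apply: ple_trans yc. Qed.

Lemma plt_ple_trans y x z : plt x y -> ple y z -> plt x z.
Proof.
case: y => B g [b xb]; rewrite pleE => /(_ b).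
exact: ple_plt_trans.
Qed.

Lemma plt_ple x y : plt x y -> ple x y.
Proof.
elim: x y => A f IH [B g] [b xb]; rewrite pleE => a; exists b.
by apply: IH; move: xb; rewrite pleE; apply.
Qed.

Lemma ple_total x y : ple x y \/ plt y x.
Proof.
elim: x y => A f IH y; rewrite pleE.
case: (pselect (forall a, plt (f a) y)) => [|/existsNP[a fay]]; first by left.
right; exists a; case: y fay => B g fay; rewrite pleE => b.
by case: (IH a (g b)) => // fagb; case: fay; exists b.
Qed.

Lemma plt_irr x : ~ plt x x.
Proof.
elim: x => A f IH [a fa]; apply: (IH a).
by move: fa; rewrite pleE; apply.
Qed.

Lemma plt_wf : well_founded plt.
Proof.
suff H y x : ple x y -> Acc plt x by move=> x; apply: (H x); apply: ple_refl.
elim: y x => A f IH x xA; constructor=> z zx.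
have [a za] : plt z (Sup f) by apply: plt_ple_trans xA.
exact: IH za.
Qed.

HB.instance Definition _ := gen_eqMixin preord.
HB.instance Definition _ := gen_choiceMixin preord.

Definition preord_eqv (x y : preord) : bool := `[< ple x y /\ ple y x >].

Lemma preord_eqv_refl : reflexive preord_eqv.
Proof. by move=> x; apply/asboolP; split; apply: ple_refl. Qed.

Lemma preord_eqv_sym : symmetric preord_eqv.
Proof. by move=> x y; apply/asboolP/asboolP => -[]. Qed.

Lemma preord_eqv_trans : transitive preord_eqv.
Proof.
move=> y x z /asboolP[xy yx] /asboolP[yz zy]; apply/asboolP.
by split; apply: (@ple_trans y).
Qed.

Canonical preord_equiv :=
  EquivRel preord_eqv preord_eqv_refl preord_eqv_sym preord_eqv_trans.

Definition ordnum := {eq_quot preord_equiv}%qT.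

HB.instance Definition _ := Choice.on ordnum.

Definition ord_of (x : preord) : ordnum := (\pi_({eq_quot preord_equiv}) x)%qT.
Definition ord_repr (a : ordnum) : preord := repr a.

Lemma ord_reprK a : ord_of (ord_repr a) = a.
Proof. exact: reprK. Qed.

Lemma repr_ord_of x : ple (ord_repr (ord_of x)) x /\ ple x (ord_repr (ord_of x)).
Proof.
have /eqP := reprK (ord_of x); rewrite [X in _ == X]/ord_of.
by rewrite [_ == _]pi_eq_quot => /asboolP.
Qed.

Definition ole (a b : ordnum) : bool := `[< ple (ord_repr a) (ord_repr b) >].
Definition olt (a b : ordnum) : bool := `[< plt (ord_repr a) (ord_repr b) >].

Fact ole_anti : antisymmetric ole.
Proof.
move=> a b /andP[/asboolP ab /asboolP ba].
rewrite -(ord_reprK a) -(ord_reprK b); apply/eqP.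
by rewrite [_ == _]pi_eq_quot; apply/asboolP.
Qed.

Fact ole_trans : transitive ole.
Proof.
by move=> b a c /asboolP ab /asboolP bc; apply/asboolP; apply: ple_trans bc.
Qed.

Fact ole_total : total ole.
Proof.
move=> a b; apply/orP.
have [ab|ba] := ple_total (ord_repr a) (ord_repr b); first by left; apply/asboolP.
by right; apply/asboolP; apply: plt_ple.
Qed.

Fact ordnum_display : Order.disp_t. Proof. exact: Order.Disp tt tt. Qed.

HB.instance Definition _ := @Order.Le_isPOrder.Build ordnum_display ordnum ole
  (fun a => asboolT (ple_refl _)) ole_anti ole_trans.
HB.instance Definition _ :=
  @Order.POrder_isTotal.Build ordnum_display ordnum ole_total.

Local Open Scope order_scope.

Lemma ordnum_leE (a b : ordnum) : (a <= b) <-> ple (ord_repr a) (ord_repr b).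
Proof. by split=> [/asboolP|/asboolP]. Qed.

Lemma ordnum_ltE (a b : ordnum) : (a < b) <-> plt (ord_repr a) (ord_repr b).
Proof.
rewrite ltNge; split.
  move=> /negP ba; case: (ple_total (ord_repr b) (ord_repr a)) => // /ordnum_leE.
  by move/ba.
move=> ab; apply/negP => /ordnum_leE ba.
exact: plt_irr (plt_ple_trans ab ba).
Qed.

Lemma ord_of_le x y : (ord_of x <= ord_of y) <-> ple x y.
Proof.
have [x1 x2] := repr_ord_of x; have [y1 y2] := repr_ord_of y.
rewrite ordnum_leE; split=> H.
  exact: ple_trans x2 (ple_trans H y1).
exact: ple_trans x1 (ple_trans H y2).
Qed.

Lemma ord_of_lt x y : (ord_of x < ord_of y) <-> plt x y.
Proof.
have [x1 x2] := repr_ord_of x; have [y1 y2] := repr_ord_of y.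
rewrite ordnum_ltE; split=> H.
  exact: ple_plt_trans x2 (plt_ple_trans H y1).
exact: ple_plt_trans x1 (plt_ple_trans H y2).
Qed.

Lemma ordnum_lt_wf : well_founded (fun a b : ordnum => a < b).
Proof.
apply: wf_incl (wf_inverse_image _ _ _ ord_repr plt_wf).
by move=> a b /ordnum_ltE.
Qed.

Lemma ordnum_minimum (P : set ordnum) : P !=set0 ->
  exists2 a, P a & forall b, P b -> a <= b.
Proof.
case=> a; elim: a / (ordnum_lt_wf a) => a _ IH Pa.
case: (pselect (exists2 b, P b & b < a)) => [[b Pb ba]|nP]; first exact: IH Pb.
by exists a => // b Pb; rewrite leNgt; apply/negP => ba; apply: nP; exists b.
Qed.

Lemma ordnum_ubound (a : nat -> ordnum) : exists b, forall n, a n < b.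
Proof.
exists (ord_of (Sup (fun n => ord_repr (a n)))) => n.
rewrite -(ord_reprK (a n)); apply/ord_of_lt; exists n.
exact: ple_refl.
Qed.

Fixpoint pfin (n : nat) : preord :=
  if n is m.+1 then Sup (fun _ : unit => pfin m) else Sup (of_void preord).

Definition ord_fin (n : nat) : ordnum := ord_of (pfin n).

Definition ord_omega : ordnum := ord_of (Sup pfin).

Lemma ord_finS n (a : ordnum) : (a < ord_fin n.+1) = (a <= ord_fin n).
Proof.
rewrite -(ord_reprK a); apply/idP/idP.
  by move=> /ord_of_lt [_ H]; apply/ord_of_le.
by move=> /ord_of_le H; apply/ord_of_lt; exists tt.
Qed.

Lemma ord_fin0 (a : ordnum) : (a < ord_fin 0) = false.
Proof. by rewrite -(ord_reprK a); apply/negP => /ord_of_lt -[[]]. Qed.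

Lemma ord_fin_lt_omega n : ord_fin n < ord_omega.
Proof. by apply/ord_of_lt; exists n; apply: ple_refl. Qed.

Lemma lt_omegaP (a : ordnum) : a < ord_omega -> exists n, a = ord_fin n.
Proof.
rewrite -(ord_reprK a) => /ord_of_lt [n].
rewrite -ord_of_le ord_reprK -/(ord_fin n).
elim: n => [|n IH]; rewrite le_eqVlt => /predU1P[->|]; first by exists 0%N.
- by rewrite ord_fin0.
- by exists n.+1.
- by rewrite ord_finS.
Qed.

Lemma ord_fin_lt m n : (ord_fin m < ord_fin n) = (m < n)%N.
Proof.
have mono : {homo ord_fin : i j / (i < j)%N >-> i < j}.
  move=> i j; elim: j => // j IH; rewrite ltnS leq_eqVlt ord_finS.
  by case/predU1P => [->//|/IH/ltW].
case: (ltngtP m n) => [/mono //|/mono/ltW|->]; last by rewrite ltxx.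
by rewrite leNgt => /negbTE.
Qed.

Lemma ord_fin_inj : injective ord_fin.
Proof.
move=> m n mn; have := ord_fin_lt m n; have := ord_fin_lt n m.
by rewrite mn ltxx; case: ltngtP.
Qed.

Variant sign := Plus | Minus.

Definition flip (e : sign) : sign := if e is Plus then Minus else Plus.

(* A function from an ordinal to signs is encoded as a partial function on all
   the ordinals ([None] = undefined) whose domain is a proper initial segment;
   [isSome] coerces [place a] to the assertion that place [a] is defined. *)
Record surreal := Surreal {
  place :> ordnum -> option sign ;
  place_initial : forall a b, b <= a -> place a -> place b ;
  place_bounded : exists a, ~~ place a }.

Lemma surreal_ext (s t : surreal) : (forall a, s a = t a) -> s = t.
Proof.
case: s t => [p pi pb] [q qi qb] /= /funext pq; subst q.
by congr Surreal; apply: Prop_irrelevance.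
Qed.

HB.instance Definition _ := gen_eqMixin surreal.
HB.instance Definition _ := gen_choiceMixin surreal.

(* Minus < undefined < Plus *)
Definition sign_rank (e : option sign) : nat :=
  match e with Some Minus => 0 | None => 1 | Some Plus => 2 end.

Definition slt (s t : surreal) : Prop :=
  exists2 a, forall b, b < a -> s b = t b & (sign_rank (s a) < sign_rank (t a))%N.

Section Surreals_of_length_at_most_omega.
Variable f : nat -> option sign.
Hypothesis f_initial : forall n, f n.+1 -> f n.

Let f_place (a : ordnum) : option sign :=
  if pselect (exists n, a = ord_fin n) is left ex_n then f (projT1 (cid ex_n))
  else None.

Let f_placeE n : f_place (ord_fin n) = f n.
Proof.
rewrite /f_place; case: pselect => [h|[]]; last by exists n.
by case: cid => m /= /ord_fin_inj ->.
Qed.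

Let f_place_ge a : ord_omega <= a -> f_place a = None.
Proof.
move=> oa; rewrite /f_place; case: pselect => // -[n an].
by exfalso; move: oa; rewrite an leNgt ord_fin_lt_omega.
Qed.

Fact seq_surreal_initial a b : b <= a -> f_place a -> f_place b.
Proof.
move=> ba; have [oa|/lt_omegaP[n an]] := leP ord_omega a.
  by rewrite f_place_ge.
have /lt_omegaP[m bm] : b < ord_omega.
  by apply: le_lt_trans ba _; rewrite an ord_fin_lt_omega.
move: ba; rewrite an bm !f_placeE leNgt ord_fin_lt -leqNgt => /subnK <-.
by elim: (n - m)%N => // k IH; rewrite addSn => /f_initial.
Qed.

Fact seq_surreal_bounded : exists a, ~~ f_place a.
Proof. by exists ord_omega; rewrite f_place_ge. Qed.

(* the surreal whose sign at each finite place [n] is [f n], of length <= omega *)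
Definition seq_surreal : surreal :=
  Surreal seq_surreal_initial seq_surreal_bounded.

Lemma seq_surrealE n : seq_surreal (ord_fin n) = f n.
Proof. exact: f_placeE. Qed.

Lemma seq_surreal_ge a : ord_omega <= a -> seq_surreal a = None.
Proof. exact: f_place_ge. Qed.

End Surreals_of_length_at_most_omega.

Definition szero : surreal :=
  @seq_surreal (fun _ => None) (fun _ => id).

Definition somega : surreal :=
  @seq_surreal (fun _ => Some Plus) (fun _ => id).

Definition sinv_omega : surreal :=
  @seq_surreal (fun n => Some (if n == 0 then Plus else Minus)) (fun _ _ => isT).

Fact sopp_initial (s : surreal) a b : b <= a ->
  omap flip (s a) -> omap flip (s b).
Proof. by move=> ba; have := place_initial ba (s := s); case: (s a) (s b) => [?|] [?|] //= ->. Qed.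

Fact sopp_bounded (s : surreal) : exists a, ~~ omap flip (s a).
Proof. by have [a sa] := place_bounded s; exists a; case: (s a) sa. Qed.

Definition sopp (s : surreal) : surreal :=
  Surreal (@sopp_initial s) (@sopp_bounded s).

Fact srestrict_initial (s : surreal) c a b : b <= a ->
  (if a < c then s a else None) -> (if b < c then s b else None).
Proof.
move=> ba; case: ifP => // ac sa; rewrite (le_lt_trans ba ac).
exact: place_initial ba sa.
Qed.

Fact srestrict_bounded (s : surreal) c :
  exists a, ~~ (if a < c then s a else None).
Proof. by exists c; rewrite ltxx. Qed.

Definition srestrict (s : surreal) (c : ordnum) : surreal :=
  Surreal (@srestrict_initial s c) (@srestrict_bounded s c).

Definition sbetween (L R : set surreal) : set surreal :=
  [set z | (forall x, L x -> slt x z) /\ (forall y, R y -> slt z y)].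

Definition no_longer (s t : surreal) : Prop := forall a, s a -> t a.

(* {L | R}: the surreal of least length lying strictly between L and R *)
Definition scut (L R : set surreal) : surreal :=
  xget szero [set z | sbetween L R z /\
                      forall w, sbetween L R w -> no_longer z w].

(* [options Plus s] and [options Minus s] are the left and right options of [s],
   that is the proper initial segments of [s] below, respectively above, [s] *)
Definition options (e : sign) (s : surreal) : set surreal :=
  [set srestrict s a | a in [set a | s a = Some e]].

Definition is_option (s' s : surreal) : Prop := exists e, options e s s'.

Lemma is_option_wf : well_founded is_option.
Proof.
pose undef (s : surreal) : set ordnum := [set a | ~~ s a].
pose len s := xget (ord_fin 0) [set a | undef s a /\ forall b, undef s b -> a <= b].
have lenP s : undef s (len s) /\ forall b, undef s b -> len s <= b.
  apply: (@xgetPex _ _ [set a | undef s a /\ forall b, undef s b -> a <= b]).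
  have [a ua ma] := ordnum_minimum (place_bounded s : undef s !=set0).
  by exists a.
suff lt_len s t : is_option s t -> len s < len t.
  exact: wf_incl lt_len (wf_inverse_image _ _ _ len ordnum_lt_wf).
case=> e [a /= ta <-]; have [_ /(_ a)] := lenP (srestrict t a).
rewrite /undef /= ltxx => /(_ isT) /le_lt_trans; apply.
have [ut _] := lenP t; rewrite ltNge; apply/negP => la.
by move: ut; rewrite /undef /= (place_initial la)// ta.
Qed.

Lemma srestrict_option (s : surreal) a e : s a = Some e -> is_option (srestrict s a) s.
Proof. by move=> sa; exists e, a. Qed.

Definition sadd_rec (p : surreal * surreal) :
    (forall q, symprod _ _ is_option is_option q p -> surreal) -> surreal :=
  let: (x, y) := p in fun add =>
  let sums e : set surreal := [set z |
       (exists a (xa : x a = Some e),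
          z = add (srestrict x a, y) (left_sym _ _ _ _ _ _ (srestrict_option xa) y))
    \/ (exists a (ya : y a = Some e),
          z = add (x, srestrict y a) (right_sym _ _ _ _ _ _ (srestrict_option ya) x))] in
  scut (sums Plus) (sums Minus).

Definition sadd (x y : surreal) : surreal :=
  Fix (wf_symprod _ _ _ _ is_option_wf is_option_wf) (fun=> surreal) sadd_rec (x, y).

(* x + y = {x' + y, x + y' | x'' + y, x + y''} for x', y' (resp. x'', y'')
   ranging over the left (resp. right) options of x and y *)
Lemma saddE x y :
  let sums e := (sadd^~ y @` options e x) `|` (sadd x @` options e y) in
  sadd x y = scut (sums Plus) (sums Minus).
Proof.
rewrite /sadd Fix_eq /=; last first.
  move=> [u v] f g fg; suff -> : f = g by [].
  by apply/functional_extensionality_dep => q; apply: funext => h; apply: fg.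
suff H e : [set z | (exists a (_ : x a = Some e), z = sadd (srestrict x a) y)
                 \/ (exists a (_ : y a = Some e), z = sadd x (srestrict y a))]
    = (sadd^~ y @` options e x) `|` (sadd x @` options e y).
  by rewrite -!H.
apply/seteqP; split=> z /=.
  case=> -[a [ha ->]]; [left|right].
    by exists (srestrict x a) => //; exists a.
  by exists (srestrict y a) => //; exists a.
by case=> -[_ [a ha <-] <-]; [left|right]; exists a, ha.
Qed.

Definition stable_from (s : nat -> surreal) (c : ordnum) (m : nat) : Prop :=
  forall n, (m <= n)%N -> forall c', c' <= c -> s n c' /\ s n c' = s m c'.

Definition slim_place (s : nat -> surreal) (c : ordnum) : option sign :=
  if pselect (exists m, stable_from s c m) is left ex_m
  then s (projT1 (cid ex_m)) c else None.

Lemma slim_placeE s c m : stable_from s c m -> slim_place s c = s m c.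
Proof.
move=> sm; rewrite /slim_place; case: pselect => [ex_m|[]]; last by exists m.
case: cid => k /= sk.
have [_ <-] := sk _ (leq_maxl k m) _ (lexx c).
by have [_ <-] := sm _ (leq_maxr k m) _ (lexx c).
Qed.

Lemma slim_place_defined s c : slim_place s c <-> exists m, stable_from s c m.
Proof.
split; first by rewrite /slim_place; case: pselect.
by case=> m sm; rewrite (slim_placeE sm); have [] := sm _ (leqnn m) _ (lexx c).
Qed.

Fact slim_initial s a b : b <= a -> slim_place s a -> slim_place s b.
Proof.
move=> ba /slim_place_defined[m sm]; apply/slim_place_defined; exists m.
by move=> n mn c cb; apply: sm => //; apply: le_trans cb ba.
Qed.

Fact slim_bounded s : exists a, ~~ slim_place s a.
Proof.
pose a n := projT1 (cid (place_bounded (s n))).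
have [b ab] := ordnum_ubound a; exists b; apply/negP.
move=> /slim_place_defined[m /(_ m (leqnn m) (a m) (ltW (ab m)))[]].
by rewrite /a; case: cid => c /= /negP.
Qed.

Definition slim (s : nat -> surreal) : surreal :=
  Surreal (@slim_initial s) (@slim_bounded s).

Section RealSurreal.
Context {R : realType}.
Local Open Scope ring_scope.

(* Only relevant when [lo] and [hi] are the nearest left and right options of a
   finite sign expansion (infinite if there is none): this is then the value of
   that expansion, the simplest number strictly between [lo] and [hi]. *)
Definition simplest_dyadic (lo hi : \bar R) : R :=
  match lo, hi with
  | EFin a, EFin b => (a + b) / 2
  | EFin a, _ => a + 1
  | _, EFin b => b - 1
  | _, _ => 0
  end.

(* The bounds [(lo, hi)] reached after reading [n] signs of the expansion of [r]:
   [simplest_dyadic lo hi] is the dyadic number with that finite expansion, and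
   the next sign of [r] tells on which side of that number [r] lies, the
   expansion of [r] stopping if they are equal. *)
Fixpoint real_bounds (r : R) (n : nat) : \bar R * \bar R :=
  if n is m.+1 then
    let: (lo, hi) := real_bounds r m in
    let c := simplest_dyadic lo hi in
    if c < r then (c%:E, hi) else if r < c then (lo, c%:E) else (lo, hi)
  else (-oo, +oo)%E.

Definition real_approx (r : R) (n : nat) : R :=
  let: (lo, hi) := real_bounds r n in simplest_dyadic lo hi.

Definition real_sign (r : R) (n : nat) : option sign :=
  if real_approx r n < r then Some Plus
  else if r < real_approx r n then Some Minus else None.

Fact real_sign_initial (r : R) n : real_sign r n.+1 -> real_sign r n.
Proof.
rewrite /real_sign /real_approx /=; case: (real_bounds r n) => lo hi.
by case: (ltgtP (simplest_dyadic lo hi) r) => // cr; rewrite cr ltxx.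
Qed.

Definition real_surreal (r : R) : surreal := seq_surreal (@real_sign_initial r).

Definition ereal_surreal (x : \bar R) : surreal :=
  match x with
  | EFin r => real_surreal r
  | +oo%E => somega
  | -oo%E => sopp somega
  end.

End RealSurreal.

(* Main.v *)
(* A real number, and likewise [d + k / omega] for [d] dyadic and [k] in [-1, 1],
   is the path followed in the dyadic tree by the cut that it makes in the
   dyadic numbers; [omega] always goes right.  If, at every dyadic [c], the
   position of [r_n] relative to [c] is eventually that of [s], then the s-limit
   is [s].  For a finite limit [r] and [s = r] this can only fail at [c = r],
   when [r] is dyadic: the s-limit is [r + 1 / omega] or [r - 1 / omega] if [r_n]
   eventually stays strictly on one side of [r], and [r] otherwise.

   It remains to see that subtracting [1 / omega] gives [r] back.  By induction
   on options, [d + k / omega] and [d' + k' / omega] have the expected sum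
   [(d + d') + (k + k') / omega]: this number lies in the cut that defines the
   sum, and each of its options is dominated by one of the options defining the
   cut, so it is the simplest number there.  For [k = k' = 0], take the coarsest
   grid of mesh [2 ^- n] containing [d] and [d']: unless both are integers, one
   of them has both its neighbours in the grid as options, whereas the options
   of [d + d'] stay in the grid. *)
Require Import Defs.
From mathcomp Require Import all_boot all_order all_algebra.
From mathcomp Require Import all_classical all_reals all_analysis.
From mathcomp Require Import ring lra zify.

Set Implicit Arguments.
Unset Strict Implicit.
Unset Printing Implicit Defensive.

Import Order.TTheory GRing.Theory Num.Theory.
Import numFieldNormedType.Exports.
Local Open Scope classical_set_scope.
Local Open Scope ring_scope.

(** * Cuts of surreals *)

Lemma sign_rank_inj : injective sign_rank.
Proof. by case=> [[]|] [[]|]. Qed.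

Lemma place_undef (s : surreal) a b : (b <= a)%O -> s b = None -> s a = None.
Proof.
move=> ba sb; case sa : (s a) => //.
by have := place_initial ba (s := s); rewrite sa sb => /(_ isT).
Qed.

Lemma omega_ext (s t : surreal) :
  s ord_omega = None -> t ord_omega = None ->
  (forall n, s (ord_fin n) = t (ord_fin n)) -> s = t.
Proof.
move=> s0 t0 st; apply: surreal_ext => a.
have [oa|/lt_omegaP[n ->//]] := leP ord_omega a.
by rewrite !(place_undef oa).
Qed.

Lemma slt_trans (x y z : surreal) : slt x y -> slt y z -> slt x z.
Proof.
move=> [a xy ra] [b yz rb].
have [ab|ba|ab] := ltgtP a b.
- exists a => [c ca|]; last by rewrite -yz.
  by rewrite xy// yz// (lt_trans ca).
- exists b => [c cb|]; last by rewrite xy.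
  by rewrite xy ?yz// (lt_trans cb).
- subst b; exists a => [c ca|]; first by rewrite xy// yz.
  exact: ltn_trans rb.
Qed.

Definition sdir (e : sign) (x y : surreal) : Prop :=
  if e is Plus then slt x y else slt y x.

Lemma sdir_trans e x y z : sdir e x y -> sdir e y z -> sdir e x z.
Proof. by case: e => /= xy yz; [apply: slt_trans yz|apply: slt_trans xy]. Qed.

Lemma srestrict_sdir e (s : surreal) a : s a = Some e ->
  sdir e (srestrict s a) s.
Proof.
by case: e => sa; exists a => [b ba|] /=; rewrite ?ba ?ltxx ?sa.
Qed.

(** If [w] were also undefined at [a], both would be undefined from there on and never differ. So
    they first differ at [a], and the direction fixes the sign of [w]. *)
Lemma sdir_place e (y w : surreal) a : sdir e y w ->
  (forall b, (b < a)%O -> y b = w b) -> y a = None -> w a = Some e.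
Proof.
move=> yw yEw ya.
have [b yb wb] : exists2 b, (forall c, (c < b)%O -> y c = w c) &
    if e is Plus then (sign_rank (y b) < sign_rank (w b))%N
    else (sign_rank (w b) < sign_rank (y b))%N.
  by case: e yw => -[b H rb]; exists b => // c cb; rewrite H.
have [ba|ab|ab] := ltgtP b a.
- by move: wb; rewrite yEw// ltnn; case: e {yw}.
- move: wb; rewrite (place_undef (ltW ab) ya) (place_undef (ltW ab) _)//.
    by case: e {yw}.
  by rewrite -yb.
- by move: wb; rewrite ab ya; case: e {yw}; case: (w a) => [[]|].
Qed.

(** By induction on the place: if [w] agrees with [z] below [a], then [srestrict z a] and [w] first
    differ at [a], and the side on which [w] lies gives the sign there. *)
Lemma extend_of_sdir (z w : surreal) :
  (forall e a, z a = Some e -> sdir e (srestrict z a) w) ->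
  forall a, z a -> w a = z a.
Proof.
move=> zw a; elim: a / (ordnum_lt_wf a) => a _ IH za.
have [e zae] : exists e, z a = Some e by case: (z a) za => // e; exists e.
rewrite zae; apply: sdir_place (zw _ _ zae) _ _ => [b ba|];
  last by rewrite /= ltxx.
by rewrite /= ba IH//; apply: place_initial (ltW ba) za.
Qed.

(** Cofinality criterion. Every [w] in the cut lies beyond all options of [z], hence extends [z];
    since [scut L R] extends [z] and is no longer than it, the two are equal. *)
Lemma scut_eq (L R : set surreal) (z : surreal) :
  sbetween L R z ->
  (forall e a, z a = Some e ->
     exists2 x, (if e is Plus then L else R) x &
       srestrict z a = x \/ sdir e (srestrict z a) x) ->
  scut L R = z.
Proof.
move=> zLR cof.
have zw w : sbetween L R w -> forall a, z a -> w a = z a.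
  move=> [Lw wR]; apply: extend_of_sdir => e a /cof[x ex zx].
  have xw : sdir e x w by case: e ex {zx} => ?; [apply: Lw|apply: wR].
  by case: zx => [->//|zx]; apply: sdir_trans xw.
have : exists z, sbetween L R z /\ forall w, sbetween L R w -> no_longer z w.
  by exists z; split=> // w /zw H a za; rewrite H.
move=> /(@xgetPex _ szero); rewrite -/(scut L R) => -[/zw H1 /(_ _ zLR) H2].
apply: surreal_ext => a; case za : (z a) => [e|]; first by rewrite H1 ?za.
by case ca : (scut L R a) => //; have := H2 a; rewrite ca za => /(_ isT).
Qed.

Lemma szeroE a : szero a = None.
Proof.
have [oa|/lt_omegaP[n ->]] := leP ord_omega a; first by rewrite seq_surreal_ge.
by rewrite seq_surrealE.
Qed.

(* The union in [saddE] is the join of the lattice of sets. *)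
Lemma sadd_scut x y :
  let sums e := [set sadd x' y | x' in options e x] `|`
                [set sadd x y' | y' in options e y] in
  sadd x y = scut (sums Plus) (sums Minus).
Proof. exact: saddE. Qed.

Lemma sadd0 x : sadd x szero = x.
Proof.
elim/(well_founded_ind is_option_wf): x => x IH.
rewrite sadd_scut /=.
have E e : [set sadd x' szero | x' in options e x] `|`
    [set sadd x y' | y' in options e szero] = options e x.
  apply/seteqP; split => [z [[y xy <-]|[y [a ya _]]]|z xz].
  - by rewrite IH//; exists e.
  - by have : szero a = Some e := ya; rewrite szeroE.
  - by left; exists z => //; rewrite IH//; exists e.
rewrite !E; apply: scut_eq => [|e a xa]; last first.
  by exists (srestrict x a); [case: e xa => xa; exists a|left].
by split=> _ [a xa <-]; apply: (srestrict_sdir xa).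
Qed.

(** * Paths in the dyadic tree *)

Section Paths.
Context {R : realType}.
Implicit Types (g h : R -> option sign) (r : R) (lo hi : \bar R).

(* The path in the dyadic tree that turns, at each dyadic number [c] that it
   meets, in the direction [g c], and stops there if [g c] is [None]. *)
Fixpoint path_bounds g (n : nat) : \bar R * \bar R :=
  if n is m.+1 then
    let: (lo, hi) := path_bounds g m in
    let c := simplest_dyadic lo hi in
    match g c with
    | Some Plus => (c%:E, hi)
    | Some Minus => (lo, c%:E)
    | None => (lo, hi)
    end
  else (-oo, +oo)%E.

Definition node g n := simplest_dyadic (path_bounds g n).1 (path_bounds g n).2.

Lemma path_boundsS g n : path_bounds g n.+1 =
  match g (node g n) with
  | Some Plus => ((node g n)%:E, (path_bounds g n).2)
  | Some Minus => ((path_bounds g n).1, (node g n)%:E)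
  | None => path_bounds g n
  end.
Proof. by rewrite /node /=; case: (path_bounds g n). Qed.

Definition path_sign g n : option sign := g (node g n).

Fact path_sign_initial g n : path_sign g n.+1 -> path_sign g n.
Proof.
rewrite /path_sign; case gn : (g (node g n)) => //.
by rewrite /node path_boundsS gn -/(node g n) gn.
Qed.

Lemma path_sign_le g i j : (i <= j)%N -> path_sign g j -> path_sign g i.
Proof.
move=> /subnK <-; elim: (j - i)%N => // k IH; rewrite addSn => gS.
exact/IH/path_sign_initial.
Qed.

Definition spath g : surreal := seq_surreal (@path_sign_initial g).

Lemma pathE g n : spath g (ord_fin n) = g (node g n).
Proof. exact: seq_surrealE. Qed.

Lemma path_omega g : spath g ord_omega = None.
Proof. by rewrite /spath seq_surreal_ge. Qed.

Lemma path_ext (s : surreal) g : s ord_omega = None ->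
  (forall n, s (ord_fin n) = g (node g n)) -> s = spath g.
Proof.
by move=> s0 sg; apply: omega_ext => // [|n]; rewrite ?path_omega// pathE.
Qed.

Lemma simplest_between lo hi : (lo < hi)%E ->
  (lo < (simplest_dyadic lo hi)%:E)%E /\ ((simplest_dyadic lo hi)%:E < hi)%E.
Proof.
by case: lo hi => [a||] [b||] //=; rewrite ?lte_fin ?ltNyr ?ltry// => ab;
  split=> //; lra.
Qed.

Lemma path_bounds_lt g n : ((path_bounds g n).1 < (path_bounds g n).2)%E.
Proof.
elim: n => // n /simplest_between[]; rewrite -/(node g n) path_boundsS.
by case: (g _) => [[]|] //= ? ?; apply: lt_trans; eassumption.
Qed.

Lemma node_between g n :
  ((path_bounds g n).1 < (node g n)%:E)%E /\ ((node g n)%:E < (path_bounds g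
    n).2)%E.
Proof. exact/simplest_between/path_bounds_lt. Qed.

Lemma path_bounds_mono g m n : (m <= n)%N ->
  ((path_bounds g m).1 <= (path_bounds g n).1)%E /\
  ((path_bounds g n).2 <= (path_bounds g m).2)%E.
Proof.
move=> /subnK <-; elim: (n - m)%N => // k [IH1 IH2].
rewrite addSn path_boundsS; have [/ltW H1 /ltW H2] := node_between g (k + m).
by case: (g _) => [[]|] //=; split=> //; apply: le_trans; eassumption.
Qed.

Lemma node_plus g m n : (m < n)%N -> g (node g m) = Some Plus ->
  node g m < node g n.
Proof.
move=> mn gm; rewrite -lte_fin; apply: le_lt_trans (node_between g n).1.
by have := (path_bounds_mono g mn).1; rewrite path_boundsS gm.
Qed.

Lemma node_minus g m n : (m < n)%N -> g (node g m) = Some Minus ->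
  node g n < node g m.
Proof.
move=> mn gm; rewrite -lte_fin; apply: lt_le_trans (node_between g n).2 _.
by have := (path_bounds_mono g mn).2; rewrite path_boundsS gm.
Qed.

Lemma node_none g m n : (m <= n)%N -> g (node g m) = None ->
  path_bounds g n = path_bounds g m.
Proof.
move=> /subnK <- gm; elim: (n - m)%N => // k IH.
by rewrite addSn path_boundsS /node IH -/(node g m) gm.
Qed.

Lemma path_bounds_lo g n a : (path_bounds g n).1 = a%:E ->
  exists m, node g m = a /\ g a = Some Plus.
Proof.
elim: n => // n IH; rewrite path_boundsS; case gn : (g _) => [[]|] //=.
by case=> <-; exists n.
Qed.

Lemma path_bounds_hi g n b : (path_bounds g n).2 = b%:E ->
  exists m, node g m = b /\ g b = Some Minus.
Proof.
elim: n => // n IH; rewrite path_boundsS; case gn : (g _) => [[]|] //=.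
by case=> <-; exists n.
Qed.

Lemma eq_path_bounds g h n :
  (forall m, (m < n)%N -> h (node g m) = g (node g m)) ->
  path_bounds h n = path_bounds g n.
Proof.
elim: n => // n IH hg; have E : path_bounds h n = path_bounds g n.
  by apply: IH => m mn; apply: hg; apply: ltnW.
by rewrite !path_boundsS /node E -/(node g n) hg.
Qed.

Lemma eq_spath g h : (forall n, h (node g n) = g (node g n)) ->
  spath h = spath g.
Proof.
move=> hg; apply: path_ext => [|n]; first exact: path_omega.
by rewrite pathE /node (@eq_path_bounds g)// hg.
Qed.

Lemma path_bounds_same_signs g h n :
  (forall m, (m < n)%N -> g (node g m) = h (node h m)) ->
  path_bounds g n = path_bounds h n.
Proof.
elim: n => // n IH H; have E := IH (fun m mn => H m (ltnW mn)).
by rewrite !path_boundsS -(H n (ltnSn n)) /node E.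
Qed.

(** At the first index where the signs differ, the same turns have been made before, so both paths
    stand at the same node. *)
Lemma path_split g h n : g (node g n) <> h (node h n) -> exists m,
  [/\ node g m = node h m, g (node g m) <> h (node h m) &
      forall k, (k < m)%N -> g (node g k) = h (node h k)].
Proof.
elim/ltn_ind: n => n IH gh.
case: (pselect (exists2 k, (k < n)%N & g (node g k) <> h (node h k))) =>
  [[k kn]|nP].
  exact: IH.
have H k : (k < n)%N -> g (node g k) = h (node h k).
  by move=> kn; apply/not_notP => ghk; apply: nP; exists k.
by exists n; split=> //; rewrite /node (path_bounds_same_signs H).
Qed.

(* The cut in the dyadic numbers filled by [d + k / omega] *)
Definition germ (d : R) (k : int) (c : R) : option sign :=
  if c < d then Some Plus else if d < c then Some Minus
  else if 0 < k then Some Plus else if k < 0 then Some Minus else None.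

Lemma germ_plusP d k c : germ d k c = Some Plus <-> c < d \/ c = d /\ 0 < k.
Proof.
rewrite /germ; case: ltgtP => cd; case: (ltgtP 0 k) => k0; split=> //;
  intuition;
  by try (subst; rewrite ltxx in cd).
Qed.

Lemma germ_minusP d k c : germ d k c = Some Minus <-> d < c \/ c = d /\ k < 0.
Proof.
rewrite /germ; case: ltgtP => cd; case: (ltgtP 0 k) => k0; split=> //;
  intuition;
  by try (subst; rewrite ltxx in cd).
Qed.

Lemma germ_noneP d k c : germ d k c = None <-> c = d /\ k = 0.
Proof.
rewrite /germ; case: ltgtP => cd; case: (ltgtP 0 k) => k0; split=> //;
  intuition;
  by subst; try rewrite ltxx in cd; try rewrite ltxx in k0.
Qed.

Lemma germ0_plusP d c : germ d 0 c = Some Plus <-> c < d.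
Proof. by split=> [/germ_plusP[//|[_]]|cd]; [rewrite ltxx|apply/germ_plusP;
  left]. Qed.

Lemma germ0_minusP d c : germ d 0 c = Some Minus <-> d < c.
Proof. by split=> [/germ_minusP[//|[_]]|cd]; [rewrite ltxx|apply/germ_minusP;
  left]. Qed.

Lemma real_bounds_path r n : real_bounds r n = path_bounds (germ r 0) n.
Proof.
by elim: n => //= n ->; case: path_bounds => lo hi; rewrite /germ; case: ltgtP.
Qed.

Lemma real_surreal_path r : real_surreal r = spath (germ r 0).
Proof.
apply: path_ext => [|n]; first by rewrite seq_surreal_ge.
rewrite seq_surrealE /real_sign; have -> : real_approx r n = node (germ r 0) n.
  by rewrite /real_approx real_bounds_path /node; case: path_bounds.
by [].
Qed.

(** Each turn of [g] before [n] points towards [node g n], so the path to that number makes the same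
    turns. *)
Lemma path_bounds_germ_node g n m : (m <= n)%N ->
  path_bounds (germ (node g n) 0) m = path_bounds g m.
Proof.
move=> mn; apply: eq_path_bounds => k km; have kn := leq_trans km mn.
case gk : (g _) => [[]|].
- by apply/germ0_plusP; apply: node_plus.
- by apply/germ0_minusP; apply: node_minus.
- by apply/germ_noneP; rewrite /node (node_none (ltnW kn) gk).
Qed.

(** This shows that every option of a path is a dyadic number, namely the node at which the path is
    cut. *)
Lemma srestrict_path g n :
  srestrict (spath g) (ord_fin n) = spath (germ (node g n) 0).
Proof.
have E a : srestrict (spath g) (ord_fin n) a =
  if (a < ord_fin n)%O then spath g a else None by [].
apply: path_ext => [|m]; rewrite {}E; first by rewrite path_omega; case: ifP.
rewrite ord_fin_lt pathE; case: ltnP => mn.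
- case gk : (g _) => [[]|];
  rewrite /node path_bounds_germ_node ?(ltnW mn)// -/(node g m); symmetry.
  + by apply/germ0_plusP; apply: node_plus.
  + by apply/germ0_minusP; apply: node_minus.
  + by apply/germ_noneP; rewrite /node (node_none (ltnW mn) gk).
- have E : germ (node g n) 0 (node (germ (node g n) 0) n) = None.
    by apply/germ_noneP; split=> //; rewrite /node path_bounds_germ_node.
  set h := germ _ 0 in E *.
  by rewrite -E /node (node_none mn E).
Qed.

End Paths.

Arguments path_bounds : simpl never.

(** * Dyadic numbers as options *)

Section Grid.
Context {R : realType}.
Implicit Types (x y z a : R).

Definition grid (n : nat) x : bool := x * 2 ^+ n \is a Num.int.

Definition mesh (n : nat) : R := 2 ^- n.

Lemma mesh0 : mesh 0 = 1. Proof. by rewrite /mesh expr0 invr1. Qed.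

Lemma meshS n : mesh n = mesh n.+1 + mesh n.+1.
Proof. by rewrite /mesh exprS; field; rewrite expf_neq0. Qed.

Lemma grid_le m n x : (m <= n)%N -> grid m x -> grid n x.
Proof. by move=> /subnKC <- mx;
  rewrite /grid exprD mulrA rpredM// rpredX// natr_int. Qed.

Lemma gridD n x y : grid n x -> grid n y -> grid n (x + y).
Proof. by rewrite /grid mulrDl => *; rewrite rpredD. Qed.

Lemma gridN n x : grid n x -> grid n (- x).
Proof. by rewrite /grid mulNr rpredN. Qed.

Lemma grid0 n : grid n 0.
Proof. by rewrite /grid mul0r rpred0. Qed.

Lemma grid_mesh n : grid n (mesh n).
Proof. by rewrite /grid /mesh mulVf ?rpred1// expf_neq0. Qed.

Lemma grid_gap n x y : grid n x -> grid n y -> x < y -> x + mesh n <= y.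
Proof.
rewrite /grid => /intrP[i xi] /intrP[j yj] xy.
have p0 : 0 < 2 ^+ n :> R by rewrite exprn_gt0.
rewrite -(ler_pM2r p0) mulrDl xi yj /mesh mulVf ?gt_eqF//.
move: xy; rewrite -(ltr_pM2r p0) xi yj ltr_int -intrD1 ler_int; lia.
Qed.

(* The bounds of a node of the dyadic tree, and the node itself *)
Inductive tree_node : \bar R * \bar R -> R -> Prop :=
| TreeRoot : tree_node (-oo, +oo)%E 0
| TreeRight a of 0 <= a & grid 0 a : tree_node (a%:E, +oo%E) (a + 1)
| TreeLeft a of a <= 0 & grid 0 a : tree_node (-oo%E, a%:E) (a - 1)
| TreeInner j a b c of grid j a & b = a + mesh j & c = a + mesh j.+1 :
    tree_node (a%:E, b%:E) c.

Lemma gridS_mesh n x : grid n x -> grid n.+1 (x + mesh n.+1).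
Proof. by move=> nx; apply: gridD (grid_le (leqnSn n) nx) (grid_mesh _). Qed.

Lemma grid0D1 x : grid 0 x -> grid 0 (x + 1).
Proof. by move=> x0; rewrite gridD// -mesh0 grid_mesh. Qed.

Lemma grid0B1 x : grid 0 x -> grid 0 (x - 1).
Proof. by move=> x0; rewrite gridD// gridN// -mesh0 grid_mesh. Qed.

Lemma tree_node_right b c : tree_node b c ->
  tree_node (c%:E, b.2) (simplest_dyadic c%:E b.2).
Proof.
case=> [|a a0 ga|a a0 ga|j a {}b {}c ga -> ->] /=.
- by apply: TreeRight; rewrite ?grid0.
- by apply: TreeRight; [lra|apply: grid0D1].
- by apply: (@TreeInner 0); [apply: grid0B1|rewrite mesh0;
  lra|have := meshS 0; rewrite mesh0; lra].
- by apply: (@TreeInner j.+1); [apply: gridS_mesh|have := meshS j; lra|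
    have := meshS j; have := meshS j.+1; lra].
Qed.

Lemma tree_node_left b c : tree_node b c ->
  tree_node (b.1, c%:E) (simplest_dyadic b.1 c%:E).
Proof.
case=> [|a a0 ga|a a0 ga|j a {}b {}c ga -> ->] /=.
- by apply: TreeLeft; rewrite ?grid0.
- by apply: (@TreeInner 0); [|rewrite mesh0|have := meshS 0; rewrite mesh0;
  lra].
- by apply: TreeLeft; [lra|apply: grid0B1].
- by apply: (@TreeInner j.+1); [apply: grid_le ga|have := meshS j|
    have := meshS j.+1; lra].
Qed.

Lemma node_tree g n : tree_node (path_bounds g n) (node g n).
Proof.
elim: n => [|n IH]; first exact: TreeRoot.
rewrite [node g n.+1]/node path_boundsS.
by case: (g _) => [[]|] //; [apply: tree_node_right|apply: tree_node_left].
Qed.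

Lemma germ0_between z n : ((path_bounds (germ z 0) n).1 < z%:E)%E /\
  (z%:E < (path_bounds (germ z 0) n).2)%E.
Proof.
elim: n => [|n [H1 H2]]; first by rewrite /= ltNyr ltry.
rewrite path_boundsS; case gc : (germ _ _ _) => [[]|] //=; split=> //.
  by rewrite lte_fin; apply/germ0_plusP.
by rewrite lte_fin; apply/germ0_minusP.
Qed.

(** An interval of mesh [2 ^- j] with endpoints on its grid and [z] strictly inside forces [j < n],
    so its midpoint is still on the grid of [z]. *)
Lemma node_grid n z m : grid n z -> grid n (node (germ z 0) m).
Proof.
move=> nz; have := germ0_between z m; case: (node_tree _ m) => /=.
- by rewrite grid0.
- by move=> a _ ga _; apply: grid_le (grid0D1 ga).
- by move=> a _ ga _; apply: grid_le (grid0B1 ga).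
- move=> j a b c ga -> ->; rewrite !lte_fin => -[az zb].
  have [jn|nj] := ltnP j n; first by apply: grid_le jn (gridS_mesh ga).
  by have := grid_gap ga (grid_le nj nz) az; rewrite leNgt zb.
Qed.

Lemma node_grid_ex g n : exists m, grid m (node g n).
Proof.
case: (node_tree g n) => [|a _ ga|a _ ga|j a b c ga _ ->];
  first by exists 0%N; rewrite grid0.
- by exists 0%N; apply: grid0D1.
- by exists 0%N; apply: grid0B1.
- by exists j.+1; apply: gridS_mesh.
Qed.

(** [i] bounds the bisections left: each one raises [j], and once [n <= j] no point of the grid lies
    strictly between two neighbours. *)
Lemma node_reach_inner n z i : forall m j a b,
  path_bounds (germ z 0) m = (a%:E, b%:E) -> grid j a -> b = a + mesh j ->
  grid n z -> (n <= j + i)%N -> exists p, node (germ z 0) p = z.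
Proof.
elim: i => [|i IH] m j a b E ga b_def nz nji; subst b;
  have := germ0_between z m; rewrite E !lte_fin => -[az zb].
  rewrite addn0 in nji; exfalso.
  by have := grid_gap ga (grid_le nji nz) az; rewrite leNgt zb.
have nE : node (germ z 0) m = a + mesh j.+1.
  by rewrite /node E /=; have := meshS j; lra.
have := path_boundsS (germ z 0) m; rewrite nE E.
case gc : (germ _ _ _) => [[]|] /= E'.
- apply: (IH _ j.+1 _ _ E') => //; last by rewrite addSnnS.
    exact: gridS_mesh.
  by have := meshS j; lra.
- apply: (IH _ j.+1 _ _ E') => //; last by rewrite addSnnS.
  exact: grid_le ga.
- by exists m; rewrite nE; case/germ_noneP: gc.
Qed.

(** [i] bounds the unit steps left; the step that overshoots [z] encloses it in a unit interval,
    where bisection takes over. *)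
Lemma node_reach_right n z i : forall m a,
  path_bounds (germ z 0) m = (a%:E, +oo%E) -> grid 0 a ->
  grid n z -> z <= a + i%:R -> exists p, node (germ z 0) p = z.
Proof.
elim: i => [|i IH] m a E ga nz zai; have := germ0_between z m;
  rewrite E !lte_fin => -[az _].
  by move: az; rewrite ltNge; move: zai; rewrite addr0 => ->.
have nE : node (germ z 0) m = a + 1 by rewrite /node E.
have := path_boundsS (germ z 0) m; rewrite nE E.
case gc : (germ _ _ _) => [[]|] /= E'.
- apply: (IH _ _ E') => //; first exact: grid0D1.
  by move: zai; rewrite -natr1; lra.
- by apply: (@node_reach_inner n z n _ 0 _ _ E') => //; rewrite mesh0.
- by exists m; rewrite nE; case/germ_noneP: gc.
Qed.

Lemma node_reach_left n z i : forall m a,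
  path_bounds (germ z 0) m = (-oo%E, a%:E) -> grid 0 a ->
  grid n z -> a - i%:R <= z -> exists p, node (germ z 0) p = z.
Proof.
elim: i => [|i IH] m a E ga nz zai; have := germ0_between z m;
  rewrite E !lte_fin => -[_ az].
  by move: az; rewrite ltNge; move: zai; rewrite subr0 => ->.
have nE : node (germ z 0) m = a - 1 by rewrite /node E.
have := path_boundsS (germ z 0) m; rewrite nE E.
case gc : (germ _ _ _) => [[]|] /= E'.
- by apply: (@node_reach_inner n z n _ 0 _ _ E') => //;
  [apply: grid0B1|rewrite mesh0; lra].
- apply: (IH _ _ E') => //; first exact: grid0B1.
  by move: zai; rewrite -natr1; lra.
- by exists m; rewrite nE; case/germ_noneP: gc.
Qed.

Lemma node_reach n z : grid n z -> exists p, node (germ z 0) p = z.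
Proof.
move=> nz; have := path_boundsS (germ z 0) 0; rewrite [node _ 0]/=.
have [k zk] : exists k : nat, `|z| <= k%:R.
  by exists (Num.bound `|z|); apply/ltW/archi_boundP.
case gc : (germ _ _ _) => [[]|] /= E.
- by apply: (@node_reach_right n z k _ _ E); rewrite ?grid0// add0r;
  apply: le_trans (ler_norm _) zk.
- apply: (@node_reach_left n z k _ _ E); rewrite ?grid0// sub0r lerNl.
  by apply: le_trans zk; rewrite -normrN ler_norm.
- by exists 0%N; case/germ_noneP: gc.
Qed.

(** The values of the options of [spath (germ z k)] on side [e], as [options_path] shows. *)
Definition is_option_val z k e x :=
  germ z k x = Some e /\ exists n, node (germ z k) n = x.

(* A dyadic number is the midpoint of two options on its grid, unless it is an
   integer, whose only relevant option is the neighbouring integer towards 0. *)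
Lemma grid_options n z : grid n z -> exists m,
  [/\ grid m z, (0 < m)%N \/ 0 < z -> is_option_val z 0 Plus (z - mesh m) &
      (0 < m)%N \/ z < 0 -> is_option_val z 0 Minus (z + mesh m)].
Proof.
move=> /node_reach[m zm].
have lo := @path_bounds_lo _ (germ z 0) m;
  have hi := @path_bounds_hi _ (germ z 0) m.
case: (node_tree _ m) zm lo hi => /=.
- by move=> <- _ _; exists 0%N; rewrite grid0 ltxx; split=> // -[].
- move=> a a0 ga za /(_ _ erefl)[k [ka ka']] _; exists 0%N; rewrite mesh0;
  subst z; split.
  + exact: grid0D1.
  + by move=> _; rewrite addrK; split=> //; exists k.
  + by case=> // a1; exfalso; lra.
- move=> a a0 ga za _ /(_ _ erefl)[k [ka ka']]; exists 0%N; rewrite mesh0;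
  subst z; split.
  + exact: grid0B1.
  + by case=> // a1; exfalso; lra.
  + by move=> _; rewrite subrK; split=> //; exists k.
- move=> j a b c ga -> -> za /(_ _ erefl)[k [ka ka']] /(_ _ erefl)[l [lb lb']].
  have -> : z = a + mesh j.+1 by [].
  exists j.+1; rewrite addrK -addrA -meshS za; split; first by rewrite -za;
    apply: gridS_mesh.
    by split=> //; exists k.
  by split=> //; exists l.
Qed.

Lemma grid0_option_plus z x : grid 0 z -> is_option_val z 0 Plus x -> 0 < z.
Proof.
move=> z0 [/germ0_plusP xz [n nx]].
rewrite ltNge; apply/negP => zle0; move: nx xz.
have := germ0_between z n; case: (node_tree _ n) => /=.
- by move=> _ <-; rewrite ltNge zle0.
- move=> a a0 ga; rewrite lte_fin => -[az _]; lra.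
- move=> a a0 ga; rewrite lte_fin => -[_ za] <-.
  by have := grid_gap z0 ga za; rewrite mesh0; lra.
- move=> j a b c ga -> ->; rewrite !lte_fin => -[az zb].
  by have := grid_gap ga (grid_le (leq0n j) z0) az; rewrite leNgt zb.
Qed.

Lemma grid0_option_minus z x : grid 0 z -> is_option_val z 0 Minus x -> z < 0.
Proof.
move=> z0 [/germ0_minusP xz [n nx]].
rewrite ltNge; apply/negP => zge0; move: nx xz.
have := germ0_between z n; case: (node_tree _ n) => /=.
- by move=> _ <-; rewrite ltNge zge0.
- move=> a a0 ga; rewrite lte_fin => -[az _] <-.
  by have := grid_gap ga z0 az; rewrite mesh0; lra.
- move=> a a0 ga; rewrite lte_fin => -[_ za]; lra.
- move=> j a b c ga -> ->; rewrite !lte_fin => -[az zb].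
  by have := grid_gap ga (grid_le (leq0n j) z0) az; rewrite leNgt zb.
Qed.

End Grid.

(** * Order and addition of dyadic numbers plus a multiple of 1 / omega *)

Section GermAddition.
Context {R : realType}.
Implicit Types (c d x y : R) (k : int) (e : sign).

Definition dyadic d := exists n, grid n d.

Lemma dyadicD x y : dyadic x -> dyadic y -> dyadic (x + y).
Proof.
move=> [m mx] [n ny]; exists (maxn m n).
by apply: gridD; [apply: grid_le mx; apply: leq_maxl|apply: grid_le ny;
  apply: leq_maxr].
Qed.

Lemma dyadicN x : dyadic x -> dyadic (- x).
Proof. by move=> [n nx]; exists n; apply: gridN. Qed.

(* [d + k / omega] precedes [d' + k' / omega] in the direction [e] *)
Definition before e d k d' k' : Prop :=
  if e is Plus then d < d' \/ d = d' /\ k < k' else d' < d \/ d' = d /\ k' < k.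

Lemma germ_before e d k c : germ d k c = Some e <-> before e c 0 d k.
Proof.
case: e => /=; first exact: germ_plusP.
by split=> [/germ_minusP|H]; [|apply/germ_minusP]; intuition.
Qed.

Lemma before_shift e d k d' k' x l :
  before e d k d' k' -> before e (d + x) (k + l) (d' + x) (k' + l).
Proof. by case: e => /= -[dd'|[-> kk']]; [left; lra|right; split=> //;
  lia|left; lra|right; split=> //; lia]. Qed.

Lemma node_reach_germ d k : dyadic d -> exists n, node (germ d k) n = d.
Proof.
move=> [N /node_reach[n0 dn0]].
have ex : exists n, node (germ d 0) n == d by exists n0; apply/eqP.
(* Before the first visit to [d] the path never consults [k]. *)
case: (ex_minnP ex) => n /eqP dn nmin; exists n.
rewrite -[RHS]dn /node (@eq_path_bounds _ (germ d 0))// => m mn.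
rewrite /germ; case: ltgtP => // md.
by have := nmin m; rewrite md eqxx leqNgt mn => /(_ isT).
Qed.

Lemma germ_mono d k d' k' c : before Plus d k d' k' ->
  (sign_rank (germ d k c) <= sign_rank (germ d' k' c))%N.
Proof.
case g' : (germ d' k' c) => [[]|] /= H.
- by case: (germ d k c) => [[]|].
- suff -> : germ d k c = Some Minus by [].
  apply/germ_minusP; move/germ_minusP: g'.
  by case: H => [?|[-> ?]] [?|[cd' ?]]; [left; lra|left; lra|left|right;
    split=> //; lia].
- case/germ_noneP: g' => cd' k0'; subst c k'; case: H => [dd'|[-> k0]].
    by rewrite (_ : germ d k d' = Some Minus)//; apply/germ_minusP; left.
  by rewrite (_ : germ d' k d' = Some Minus)//; apply/germ_minusP; right.
Qed.

(** Equal signs would give a single path meeting both [d] and [d']. If [d = d'], the sign read there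
    determines [k] among -1, 0 and 1; otherwise a node between the two numbers receives opposite
    signs. *)
Lemma germ_neq d k d' k' : dyadic d -> dyadic d' -> `|k| <= 1 -> `|k'| <= 1 ->
  before Plus d k d' k' ->
  exists n, germ d k (node (germ d k) n) <> germ d' k' (node (germ d' k') n).
Proof.
move=> dd dd' k1 k1' dkd'; apply: contrapT => /forallNP H.
have {}H n : germ d k (node (germ d k) n) = germ d' k' (node (germ d' k') n).
  by apply: contrapT; apply: H.
have E n : node (germ d' k') n = node (germ d k) n.
  by rewrite /node (@path_bounds_same_signs _ (germ d k) (germ d' k')).
have {}H n : germ d k (node (germ d k) n) = germ d' k' (node (germ d k) n).
  by rewrite H E.
have [n nd] := node_reach_germ k dd.
have [n' nd'] := node_reach_germ k' dd'; rewrite E in nd'.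
case: dkd' => [ltdd'|[eqdd' kk']]; last first.
  have := H n; rewrite nd -eqdd' /germ ltxx.
  by case: (ltgtP 0 k) => ?; case: (ltgtP 0 k') => ? // _; lia.
have gd' : germ d k d' = Some Minus by apply/germ_minusP; left.
have gd : germ d' k' d = Some Plus by apply/germ_plusP; left.
(* An index past both visits: by then the path has turned right at [d] and left at [d']. *)
pose N := (maxn n n').+1.
have dN : d < node (germ d k) N.
  by rewrite -{1}nd; apply: node_plus; rewrite ?ltnS ?leq_maxl// H nd.
have Nd' : node (germ d k) N < d'.
  by rewrite -[X in _ < X]nd'; apply: node_minus; rewrite ?ltnS ?leq_maxr// nd'.
have := H N; rewrite (iffRL (germ_minusP _ _ _)); last by left.
by rewrite (iffRL (germ_plusP _ _ _)); last by left.
Qed.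

Lemma germ_separate d k d' k' : dyadic d -> dyadic d' -> `|k| <= 1 ->
  `|k'| <= 1 ->
  before Plus d k d' k' -> exists n,
  [/\ node (germ d k) n = node (germ d' k') n,
      (sign_rank (germ d k (node (germ d k) n)) <
       sign_rank (germ d' k' (node (germ d' k') n)))%N &
      forall m, (m < n)%N ->
        germ d k (node (germ d k) m) = germ d' k' (node (germ d' k') m)].
Proof.
move=> dd dd' k1 k1' H; have [n /path_split[m [mE mne mlt]]] := germ_neq dd
  dd' k1 k1' H.
exists m; split=> //; rewrite ltn_neqAle -mE germ_mono// andbT.
by apply/eqP => /sign_rank_inj; rewrite {2}mE.
Qed.

Lemma path_germ_sdir e d k d' k' : dyadic d -> dyadic d' -> `|k| <= 1 ->
  `|k'| <= 1 ->
  before e d k d' k' -> sdir e (spath (germ d k)) (spath (germ d' k')).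
Proof.
have slt_germ d1 k1 d2 k2 : dyadic d1 -> dyadic d2 -> `|k1| <= 1 ->
  `|k2| <= 1 ->
    before Plus d1 k1 d2 k2 -> slt (spath (germ d1 k1)) (spath (germ d2 k2)).
  move=> D1 D2 K1 K2 /(germ_separate D1 D2 K1 K2)[n [_ nlt nE]].
  exists (ord_fin n) => [b bn|]; last by rewrite !pathE.
  have /lt_omegaP[m mE] := lt_trans bn (ord_fin_lt_omega n).
  by move: bn; rewrite mE ord_fin_lt !pathE; apply: nE.
by case: e => *; apply: slt_germ.
Qed.

Lemma is_option_val_dyadic d k e x : is_option_val d k e x -> dyadic x.
Proof. by move=> [_ [n <-]]; apply: node_grid_ex. Qed.

Lemma options_path e d k :
  options e (spath (germ d k)) = [set spath (germ x 0) |
    x in is_option_val d k e].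
Proof.
apply/seteqP; split=> [_ [a ae <-]|_ [x [xe [n nx]] <-]].
  have ae' : spath (germ d k) a = Some e := ae.
  have [oa|/lt_omegaP[n an]] := leP ord_omega a.
    by rewrite (place_undef oa (path_omega _)) in ae'.
  subst a; rewrite pathE in ae'; rewrite srestrict_path.
  by exists (node (germ d k) n) => //; split=> //; exists n.
exists (ord_fin n); last by rewrite srestrict_path nx.
by have : spath (germ d k) (ord_fin n) = Some e by rewrite pathE nx.
Qed.

Definition dle e x y := if e is Plus then x <= y else y <= x.

(** The option is the node where the paths of [x] and [d + k / omega] separate. The latter path does
    not stop there because [k != 0], so it turns towards [e], while [x] is not beyond that node. *)
Lemma germ_approach e x d k : dyadic x -> dyadic d -> k != 0 -> `|k| <= 1 ->
  germ d k x = Some e -> exists2 c, is_option_val d k e c & dle e x c.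
Proof.
move=> dx dd k0 k1 /germ_before.
case: e => [/(germ_separate dx dd)|/(germ_separate dd dx)] [] // n [nE nlt _].
  exists (node (germ d k) n); last first.
    move: nlt; rewrite nE /= leNgt; case gx : (germ x 0 _) => [[]|] /=.
    - by case: (germ d k _) => [[]|].
    - by move/germ0_minusP: gx => /ltW/le_gtF ->.
    - by case/germ_noneP: gx => -> _; rewrite ltxx.
  split; last by exists n.
  case gd : (germ d k _) nlt => [[]|] //= _.
  by case/germ_noneP: gd => _ k00; rewrite k00 eqxx in k0.
exists (node (germ d k) n); last first.
  move: nlt; rewrite -nE /= leNgt; case gx : (germ x 0 _) => [[]|] /=.
  - by move/germ0_plusP: gx => /ltW/le_gtF ->.
  - by case: (germ d k _) => [[]|].
  - by case/germ_noneP: gx => -> _; rewrite ltxx.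
split; last by exists n.
case gd : (germ d k _) nlt => [[]|] //=; first by case: (germ x 0 _) => [[]|].
by case/germ_noneP: gd => _ k00; rewrite k00 eqxx in k0.
Qed.

End GermAddition.

(** * Cofinality of options and the sum of two germs *)

Section GermSum.
Context {R : realType}.
Implicit Types (c d x y : R) (k : int) (e : sign).

(** On the finer of the two grids, [c] is at least one mesh away from [d + d'], and moving the
    summand with that grid by one mesh gives the option. If both are integers, one of them has the
    sign of [d + d'] and so has its neighbour towards 0 as an option. *)
Lemma add_cofinal0 e d d' c : dyadic d -> dyadic d' ->
  is_option_val (d + d') 0 e c ->
  (exists2 x, is_option_val d 0 e x & dle e c (x + d')) \/
  (exists2 x, is_option_val d' 0 e x & dle e c (d + x)).
Proof.
move=> [n /grid_options[m [dm dp dn]]] [n' /grid_options[m' [dm' dp' dn']]] co.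
have gap (M : nat) : (m <= M)%N -> (m' <= M)%N ->
    if e is Plus then c + mesh M <= d + d' else d + d' + mesh M <= c.
  move=> mM m'M; have gz := gridD (grid_le mM dm) (grid_le m'M dm').
  case: co => cz [p cp]; have := node_grid p gz; rewrite cp => gc.
  by case: e cz => [/germ0_plusP|/germ0_minusP]; apply: grid_gap.
have [m'm|mm'] := leqP m' m; last first.
  have := gap m' (ltnW mm') (leqnn _); have m'0 := leq_ltn_trans (leq0n m) mm'.
  case: e {co gap} => H; right.
    by exists (d' - mesh m') => /=; [apply: dp'; left|lra].
  by exists (d' + mesh m') => /=; [apply: dn'; left|lra].
have H := gap m (leqnn _) m'm.
have left_ok : (0 < m)%N \/ (if e is Plus then 0 < d else d < 0) ->
    exists2 x, is_option_val d 0 e x & dle e c (x + d').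
  case: e {co gap} H => H m0.
    by exists (d - mesh m) => /=; [apply: dp|lra].
  by exists (d + mesh m) => /=; [apply: dn|lra].
have [m0|m0] := ltnP 0 m; first by left; apply: left_ok; left.
move: m0 m'm; rewrite leqn0 => /eqP m0; rewrite m0 leqn0 => /eqP m'0;
  subst m m'.
have gz := gridD dm dm'.
case: e co gap H left_ok => co _ /= H left_ok.
- have z0 := grid0_option_plus gz co.
  have [d0|d0] := ltP 0 d; first by left; apply: left_ok; right.
  by right; exists (d' - mesh 0); [apply: dp'; right; lra|lra].
- have z0 := grid0_option_minus gz co.
  have [d0|d0] := ltP d 0; first by left; apply: left_ok; right.
  by right; exists (d' + mesh 0); [apply: dn'; right; lra|lra].
Qed.

Definition beforeq e d k d' k' : Prop := (d = d' /\ k = k') \/ before e d k d'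
  k'.

Lemma dle_beforeq e x y : dle e x y -> beforeq e x 0 y 0.
Proof.
by case: e; rewrite /= le_eqVlt => /predU1P[->|xy]; [left|right;
  left|left|right; left].
Qed.

(** Here [k] points in direction [e], so [d] itself is an option of [d + k / omega] and serves as
    witness. *)
Lemma germ_cofinal_eps e d k d' k' c :
  `|k| <= 1 -> `|k'| <= 1 -> `|k + k'| <= 1 -> dyadic d ->
    germ d k d = Some e ->
  germ (d + d') (k + k') c = Some e ->
  exists2 x, is_option_val d k e x & beforeq e c 0 (x + d') k'.
Proof.
move=> k1 k1' kk1 dd kd /germ_before cz; exists d.
  by split=> //; apply: node_reach_germ.
case: e kd cz => [/germ_plusP|/germ_minusP] [|[_ k0]];
  rewrite ?ltxx// => -[cz|[cz kk0]];
  try by right; left.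
(* Both [k] and [k + k'] equal 1, so [k' = 0]; in the symmetric case both equal -1. *)
- by left; split=> //; lia.
- by left; split=> //; lia.
Qed.

(** Translating by [- d'] reduces this to approaching [d + k / omega] from the dyadic number
    [c - d']. *)
Lemma germ_cofinal_approach e d k d' c :
  `|k| <= 1 -> k != 0 -> dyadic d -> dyadic d' -> dyadic c ->
  germ (d + d') k c = Some e ->
  exists2 x, is_option_val d k e x & beforeq e c 0 (x + d') 0.
Proof.
move=> k1 k0 dd dd' dc /germ_before /(before_shift (- d') 0).
rewrite addrK !addr0 => /germ_before H.
have [x xo cx] := germ_approach (dyadicD dc (dyadicN dd')) dd k0 k1 H.
exists x => //; apply: dle_beforeq; case: e cx {H xo} => /=; lra.
Qed.

(** Otherwise both would have the sign opposite to [e], and their sum would have absolute value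
    2. *)
Lemma germ_sign0 d k k' e : `|k| <= 1 -> `|k'| <= 1 -> `|k + k'| <= 1 ->
  germ d k d <> Some e -> germ d k' d <> Some e -> k = 0 \/ k' = 0.
Proof.
move=> k1 k1' kk1 /germ_before H /germ_before H'.
have [->|k0] := eqVneq k 0; first by left.
right; case: e H H' => /= H H'.
  have kn : ~ 0 < k by move=> ?; apply: H; right.
  by have kn' : ~ 0 < k' by [move=> ?; apply: H'; right]; lia.
have kn : ~ k < 0 by move=> ?; apply: H; right.
by have kn' : ~ k' < 0 by [move=> ?; apply: H'; right]; lia.
Qed.

(** If [k] or [k'] points in direction [e], the corresponding dyadic part is the option. If not, one
    of them is 0: a nonzero other one is handled by approach, and two zeros by the grid argument. *)
Lemma germ_cofinal e d k d' k' c : dyadic d -> dyadic d' ->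
  `|k| <= 1 -> `|k'| <= 1 -> `|k + k'| <= 1 ->
  is_option_val (d + d') (k + k') e c ->
  (exists2 x, is_option_val d k e x & beforeq e c 0 (x + d') k') \/
  (exists2 x, is_option_val d' k' e x & beforeq e c 0 (d + x) k).
Proof.
move=> dd dd' k1 k1' kk1 co; have dc := is_option_val_dyadic co;
  have cz := co.1.
have cz' : germ (d' + d) (k' + k) c = Some e by rewrite addrC [k' + k]addrC.
have kk1' : `|k' + k| <= 1 by rewrite addrC.
have [kd|kd] := pselect (germ d k d = Some e).
  by left; apply: germ_cofinal_eps.
have [kd'|kd'] := pselect (germ d' k' d' = Some e).
  right; have [x xo cx] := germ_cofinal_eps k1' k1 kk1' dd' kd' cz'.
  by exists x; rewrite // addrC.
have [k00|k0] := eqVneq k 0.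
  subst k; rewrite add0r in co cz; have [k00|k0'] := eqVneq k' 0.
    subst k'; case: (add_cofinal0 dd dd' co) => -[x xo /dle_beforeq cx].
      by left; exists x.
    by right; exists x.
  right; rewrite addrC in cz.
  have [x xo cx] := germ_cofinal_approach k1' k0' dd' dd dc cz.
  by exists x; rewrite // addrC.
have k00 : k' = 0.
  have kd'' : germ d k' d <> Some e by move: kd'; rewrite /germ !ltxx.
  by case: (germ_sign0 k1 k1' kk1 kd kd'') => // k00; rewrite k00 eqxx in k0.
by subst k'; rewrite addr0 in cz; left; apply: germ_cofinal_approach.
Qed.

Lemma is_option_path d k e x : is_option_val d k e x ->
  is_option (spath (germ x 0)) (spath (germ d k)).
Proof. by move=> xo; exists e; rewrite options_path; exists x. Qed.

(* [spath (germ d k)] is [d + k / omega] only for [k] in [-1, 1], and the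
   options of such a number are dyadic, so that the induction never leaves this
   range. *)
Lemma sadd_germ d k d' k' : dyadic d -> dyadic d' ->
  `|k| <= 1 -> `|k'| <= 1 -> `|k + k'| <= 1 ->
  sadd (spath (germ d k)) (spath (germ d' k')) = spath (germ (d + d') (k + k')).
Proof.
move: {2}(spath (germ d k)) (erefl (spath (germ d k))) => s.
elim/(well_founded_ind is_option_wf): s d k d' k' => s IH d k d' k' sE dd.
subst s.
move: {2}(spath (germ d' k')) (erefl (spath (germ d' k'))) => t.
elim/(well_founded_ind is_option_wf): t d' k' => t IH' d' k' tE dd' k1 k1' kk1.
subst t.
(* An option has coefficient 0, so the sum has coefficient [k'] and stays within the bounds of the
   induction. *)
have sumL e x : is_option_val d k e x ->
    sadd (spath (germ x 0)) (spath (germ d' k')) = spath (germ (x + d') k').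
  move=> xo; rewrite (IH _ (is_option_path xo) x 0)// ?add0r ?normr0//.
  exact: is_option_val_dyadic xo.
have sumR e x : is_option_val d' k' e x ->
    sadd (spath (germ d k)) (spath (germ x 0)) = spath (germ (d + x) k).
  move=> xo; rewrite (IH' _ (is_option_path xo) x 0)// ?addr0 ?normr0//.
  exact: is_option_val_dyadic xo.
set z := spath (germ (d + d') (k + k')).
rewrite sadd_scut /=.
set sums := fun e => [set sadd x' (spath (germ d' k')) |
  x' in options e (spath (germ d k))] `|`
   [set sadd (spath (germ d k)) y' | y' in options e (spath (germ d' k'))].
have between e w : sums e w -> sdir e w z.
  rewrite /sums !options_path => -[[_ [x xo <-] <-]|[_ [x xo <-] <-]].
    rewrite (sumL _ _ xo); apply: path_germ_sdir => //; try exact: dyadicD.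
      exact: dyadicD (is_option_val_dyadic xo) dd'.
    by have := before_shift d' k' (iffLR (germ_before _ _ _ _) xo.1);
      rewrite add0r.
  rewrite (sumR _ _ xo); apply: path_germ_sdir => //; try exact: dyadicD.
    exact: dyadicD dd (is_option_val_dyadic xo).
  have := before_shift d k (iffLR (germ_before _ _ _ _) xo.1).
  by rewrite add0r ![_ + d]addrC [k' + k]addrC.
rewrite -/(sums Plus) -/(sums Minus).
apply: scut_eq => [|e a za]; first by split;
  [apply: (between Plus)|apply: (between Minus)].
have : options e z (srestrict z a) by exists a.
rewrite options_path => -[c co <-]; have dc := is_option_val_dyadic co.
have beforeqP y l : dyadic y -> `|l| <= 1 -> beforeq e c 0 y l ->
    spath (germ c 0) = spath (germ y l) \/ sdir e (spath (germ c 0)) (spath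
      (germ y l)).
  by move=> dy l1 [[-> <-]|cy]; [left|right; apply: path_germ_sdir].
have sumsE : (if e is Plus then sums Plus else sums Minus) = sums e by case:
  (e).
rewrite sumsE; have [[x xo cx]|[x xo cx]] := germ_cofinal dd dd' k1 k1' kk1 co.
- have dx := is_option_val_dyadic xo; exists (spath (germ (x + d') k')).
    by left; exists (spath (germ x 0)); [rewrite options_path;
      exists x|apply: sumL xo].
  by apply: beforeqP => //; apply: dyadicD.
- have dx := is_option_val_dyadic xo; exists (spath (germ (d + x) k)).
    by right; exists (spath (germ x 0)); [rewrite options_path;
      exists x|apply: sumR xo].
  by apply: beforeqP => //; apply: dyadicD.
Qed.

(** All nodes are dyadic, so the path never meets [d], the only point where [k] matters. *)
Lemma path_germ_nondyadic d k : ~ dyadic d ->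
  spath (germ d k) = spath (germ d 0).
Proof.
move=> nd; apply: eq_spath => n; rewrite /germ.
by case: ltgtP => // nE; case: nd; rewrite -nE; apply: node_grid_ex.
Qed.

Lemma sinv_omega_path : sinv_omega = spath (germ (0 : R) 1).
Proof.
apply: path_ext => [|n]; first by rewrite seq_surreal_ge.
rewrite seq_surrealE; case: n => [|n]; first by rewrite /germ /= ltxx.
symmetry; apply/germ_minusP; left.
by apply: (@node_plus _ _ 0 n.+1); rewrite // /germ /= ltxx.
Qed.

Lemma sopp_sinv_omega_path : sopp sinv_omega = spath (germ (0 : R) (-1)).
Proof.
have E a : sopp sinv_omega a = omap flip (sinv_omega a) by [].
apply: path_ext => [|n]; rewrite E; first by rewrite seq_surreal_ge.
rewrite seq_surrealE; case: n => [|n]; first by rewrite /germ /= ltxx.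
symmetry; apply/germ_plusP; left.
by apply: (@node_minus _ _ 0 n.+1); rewrite // /germ /= ltxx.
Qed.

End GermSum.

(** * Limits *)

Section Limits.
Context {R : realType}.

(** Any finite number of turns of [g] is eventually made by [h n]. Where [g] stops, the late paths
    all reach that node, and a defined limit place would make them all turn the same way there,
    which the second condition excludes. *)
Lemma slim_path (h : nat -> R -> option sign) (g : R -> option sign) :
  (forall c e, g c = Some e -> \forall n \near \oo, h n c = Some e) ->
  (forall c e, g c = None -> ~ \forall n \near \oo, h n c = Some e) ->
  slim (fun n => spath (h n)) = spath g.
Proof.
move=> hg nhg.
have H j : (forall i, (i < j)%N -> g (node g i)) ->
    \forall n \near \oo, forall i, (i < j)%N ->
      h n (node (h n) i) = g (node g i).
  elim: j => [|j IH] gj; first by apply: nearW.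
  have {}IH := IH (fun i ij => gj i (ltnW ij)).
  have [e ge] : exists e, g (node g j) = Some e.
    by case: (g _) (gj j (ltnSn j)) => // e _; exists e.
  apply: filterS2 IH (hg _ _ ge) => n IH hn i.
  rewrite ltnS leq_eqVlt => /predU1P[->|]; last exact: IH.
  by rewrite {1}/node (path_bounds_same_signs IH) -/(node g j) hn.
apply: path_ext => [|j].
  (* Every term has length at most omega, hence so does the s-limit. *)
  case E : (slim _ _) => [e|] //.
  have /slim_place_defined[m /(_ m (leqnn m) _ (lexx _))[]] :
    slim_place (fun n => spath (h n)) ord_omega by rewrite [slim_place _ _]E.
  by rewrite path_omega.
case gj : (g (node g j)) => [e|].
  have /H [m _ Hm] : forall i, (i < j.+1)%N -> g (node g i).
    by move=> i; rewrite ltnS => /path_sign_le; apply; rewrite /path_sign gj.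
  have hm n i : (m <= n)%N -> (i <= j)%N ->
    spath (h n) (ord_fin i) = g (node g i).
    by move=> mn ij; rewrite pathE (Hm n mn).
  rewrite [LHS](@slim_placeE _ _ m); first by rewrite hm.
  move=> n mn c cj.
  have /lt_omegaP[i ci] := le_lt_trans cj (ord_fin_lt_omega j); subst c.
  move: cj; rewrite leNgt ord_fin_lt -leqNgt => ij.
  rewrite !hm//; split=> //.
  by apply: path_sign_le ij _; rewrite /path_sign gj.
have ex : exists i, ~~ g (node g i) by exists j; rewrite gj.
(* It is enough that the limit be undefined at the first place [i] where [g] stops. *)
case: (ex_minnP ex) => i gi imin.
have {}gi : g (node g i) = None by case: (g _) gi.
have ij : (i <= j)%N by apply: imin; rewrite gj.
apply: (@place_undef _ _ (ord_fin i)).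
  by rewrite leNgt ord_fin_lt -leqNgt.
case E : (slim _ _) => [e|] //.
have /slim_place_defined[m sm] :
  slim_place (fun n => spath (h n)) (ord_fin i) by rewrite [slim_place _ _]E.
have {}E : spath (h m) (ord_fin i) = Some e by rewrite -E [RHS](slim_placeE sm).
exfalso; apply: (nhg _ e gi).
have /H Hi : forall p, (p < i)%N -> g (node g p).
  by move=> p pi; apply/negPn/negP => /imin; rewrite leqNgt pi.
apply: filterS2 Hi (nbhs_infty_ge m) => n Hi mn.
have [_] := sm n mn _ (lexx _); rewrite E pathE => <-.
by rewrite /node (path_bounds_same_signs Hi).
Qed.

End Limits.

(** * S-limits of real sequences with a classical limit *)

Section RealLimits.
Context {R : realType}.
Implicit Types (u : nat -> R) (r : R).

(** At [c] different from [r], convergence settles the side on which [u n] eventually lies; at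
    [c = r] the conditions on [k] do. *)
Lemma slim_germ u r (k : int) : u n @[n --> \oo] --> r ->
  (0 < k -> \forall n \near \oo, r < u n) ->
  (k < 0 -> \forall n \near \oo, u n < r) ->
  (k = 0 -> (~ \forall n \near \oo, r < u n) /\ (~ \forall n \near \oo,
    u n < r)) ->
  slim (fun n => real_surreal (u n)) = spath (germ r k).
Proof.
move=> ur kp kn k0.
have -> : (fun n => real_surreal (u n)) = (fun n => spath (germ (u n) 0)).
  by apply: funext => n; rewrite real_surreal_path.
apply: slim_path => c e.
  case: e => [/germ_plusP|/germ_minusP] H.
    suff : \forall n \near \oo, c < u n by apply: filterS => n;
      move/germ0_plusP.
    by case: H => [cr|[-> /kp //]]; apply: cvgr_gt ur _ cr.
  suff : \forall n \near \oo, u n < c by apply: filterS => n; move/germ0_minusP.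
  by case: H => [cr|[-> /kn //]]; apply: cvgr_lt ur _ cr.
move=> /germ_noneP[-> /k0[np nm]]; case: e => H.
  by apply: np; apply: filterS H => n /germ0_plusP.
by apply: nm; apply: filterS H => n /germ0_minusP.
Qed.

Lemma slim_pinfty u : (u n)%:E @[n --> \oo] --> +oo%E ->
  slim (fun n => real_surreal (u n)) = somega.
Proof.
move=> /cvgeyPgt uy.
have -> : (fun n => real_surreal (u n)) = (fun n => spath (germ (u n) 0)).
  by apply: funext => n; rewrite real_surreal_path.
(* The cut above all dyadic numbers: its path always turns right and spells [omega]. *)
rewrite (@slim_path _ _ (fun=> Some Plus))// => [|c e [<-]]; last first.
  by apply: filterS (uy c) => n; rewrite lte_fin => /germ0_plusP.
by symmetry; apply: path_ext => [|n];
  [rewrite seq_surreal_ge|rewrite seq_surrealE].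
Qed.

Lemma slim_ninfty u : (u n)%:E @[n --> \oo] --> -oo%E ->
  slim (fun n => real_surreal (u n)) = sopp somega.
Proof.
move=> /cvgeNyPlt uy.
have -> : (fun n => real_surreal (u n)) = (fun n => spath (germ (u n) 0)).
  by apply: funext => n; rewrite real_surreal_path.
rewrite (@slim_path _ _ (fun=> Some Minus))// => [|c e [<-]]; last first.
  by apply: filterS (uy c) => n; rewrite lte_fin => /germ0_minusP.
have E a : sopp somega a = omap flip (somega a) by [].
by symmetry; apply: path_ext => [|n]; rewrite E;
  [rewrite seq_surreal_ge|rewrite seq_surrealE].
Qed.

Lemma real_surreal_germ_add r (k : int) : `|k| <= 1 -> dyadic r ->
  real_surreal r = sadd (spath (germ r k)) (spath (germ (0 : R) (- k))).
Proof.
move=> k1 dr; rewrite sadd_germ// ?addr0 ?subrr ?normrN ?normr0//.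
  exact: real_surreal_path.
by exists 0%N; apply: grid0.
Qed.

End RealLimits.

Theorem theorem2 (R : realType) (r_ : nat -> R) (r : \bar R)
    (cvg_r : (r_ n)%:E @[n --> \oo] --> r) :
  exists e : surreal,
    (e = szero \/ e = sinv_omega \/ e = sopp sinv_omega) /\
    ereal_surreal r = sadd (slim (fun n => real_surreal (r_ n))) e.
Proof.
case: r cvg_r => [r||] /= cvg_r; last 2 first.
- by exists szero; split; [left|rewrite sadd0 slim_pinfty].
- by exists szero; split; [left|rewrite sadd0 slim_ninfty].
have {}cvg_r : r_ n @[n --> \oo] --> r by move/fine_cvg: cvg_r.
have [dr|nd] := pselect (dyadic r); last first.
  (* Whatever the side of approach, recorded by [k], the path is that of [r], so the error is 0. *)
  suff [k ->] : exists k, slim (fun n =>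
    real_surreal (r_ n)) = spath (germ r k).
    by exists szero; split; [left|
      rewrite sadd0 real_surreal_path path_germ_nondyadic].
  have [rp|np] := pselect (\forall n \near \oo, r < r_ n).
    by exists 1; apply: slim_germ.
  have [rn|nn] := pselect (\forall n \near \oo, r_ n < r).
    by exists (-1); apply: slim_germ.
  by exists 0; apply: slim_germ.
have [rp|np] := pselect (\forall n \near \oo, r < r_ n).
  (* Eventually strictly above [r], the sequence has s-limit [r + 1 / omega], which the error
     compensates. *)
  exists (sopp sinv_omega); split; first by right; right.
  rewrite (@slim_germ _ _ r 1)// (sopp_sinv_omega_path (R := R)).
  exact: real_surreal_germ_add.
have [rn|nn] := pselect (\forall n \near \oo, r_ n < r).
  exists sinv_omega; split; first by right; left.
  (* Rewriting 1 as the opposite of -1 displays [sinv_omega] as the correction for [k = -1]. *)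
  rewrite (@slim_germ _ _ r (-1))// (sinv_omega_path (R := R)) -{2}[1]opprK.
  exact: real_surreal_germ_add.
(* The sequence stays on neither strict side of [r], so the s-limit stops exactly at [r]. *)
exists szero; split; first by left.
by rewrite sadd0 (@slim_germ _ _ r 0)// real_surreal_path.
Qed.
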